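(* Let $\mu_0\in\mathcal{A}(\Omega_0)$ and let $\{\mu_i\}$, $\{V^{\mu_i}\}$, $\{\Omega_i\}$ be the policies, value functions and regions generated by invariantly admissible policy iteration under the standing assumptions listed in the context. If for some $k\in\{0,1,2,\dots\}$ the equality $V^{\mu_k}(x)=V^{\mu_{k+1}}(x)$ holds for all $x\in\Omega_{k+1}$, then $$\mu_k=\mu_{k+1}=\mu^*\quad\text{and}\quad V^{\mu_k}=V^{\mu_{k+1}}=V^*\quad\text{on }\Omega_{k+1}.$$
   Context: Setting: $\mathcal{D}\subseteq\mathbb{R}^n$ is the domain of $f$ and $g$ and contains a neighborhood of the origin; $f:\mathcal{D}\to\mathbb{R}^n$ with $f(0)=0$ and $g:\mathcal{D}\to\mathbb{R}^{n\times m}$ are locally Lipschitz continuous. The system is $\dot x=f(x)+g(x)u$, $x(0)=x_0\in\mathcal{D}$. The cost is $r(x,u)=Q(x)+u^TRu$, where $R\in\mathbb{R}^{m\times m}$ is a symmetric positive definite matrix and $Q:\mathcal{D}\to\mathbb{R}_+$ is positive definite on $\mathcal{D}$ (continuous, zero at $0$, positive elsewhere). All subsets of $\mathbb{R}^n$ (or $\mathcal{D}$) considered are assumed to contain a neighborhood of the origin and, without loss of generality, to have no region or point isolated from the origin. Policies: a function $\mu:\mathcal{D}\to\mathbb{R}^m$ is a policy on $\Omega\subseteq\mathcal{D}$ if $\mu$ is continuous on $\Omega$ and $\mu(0)=0$. $\phi(t;x_0,\mu)$ denotes the trajectory of $\dot x=f(x)+g(x)\mu(x)$ with $x(0)=x_0$.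 The trajectory is feasible on $\Omega$ if $x_0\in\Omega$ implies $\phi(t;x_0,\mu)\in\mathcal{D}$ for all $t\ge0$. $\mu$ asymptotically stabilizes the system on $\Omega$ if $\phi(t;x_0,\mu)$ exists for all $x_0\in\Omega$, $t\ge 0$; the equilibrium $0$ of $\dot x=f+g\mu$ is stable; and $\lim_{t\to\infty}\phi(t;x_0,\mu)=0$ for all $x_0\in\Omega$. Value function: $V^\mu(x_0)=\int_0^\infty r(\phi(\tau;x_0,\mu),\mu(\phi(\tau;x_0,\mu)))\,d\tau$ for every $x_0\in\mathcal{D}$ for which it exists. $V^\mu\in\mathcal{C}^1(\Omega)$ means its gradient (column vector) $\nabla V^\mu$ exists at each point of $\Omega$ and is continuous on $\Omega$. For $c_i>0$, $\bar\Omega_{c_i}^{\mu_i}:=\{x\in\mathbb{R}^n:V^{\mu_i}(x)\le c_i\}$ (a compact set, consisting of those points where $V^{\mu_i}$ exists and is at most $c_i$). Admissibility: $\mu\in\mathcal{A}(\Omega)$ iff $\mu$ is a policy on $\Omega$ that asymptotically stabilizes the system on $\Omega$, $\phi(t;x_0,\mu)$ is feasible on $\Omega$, and $V^\mu(x_0)<\infty$ for all $x_0\in\Omega$. Optimal solution: $\mu^*(x)=-\frac12R^{-1}g^T(x)\nabla V^*(x)$, where $V^*:=V^{\mu^*}$ is the optimal value function. The HJB equation is $0=Q(x)+\nabla V^{*T}f(x)-\frac14\nabla V^{*T}g(x)R^{-1}g^T(x)\nabla V^*$. Invariantly admissible policy iteration: start from $\mu_0\in\mathcal{A}(\Omega_0)$,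 $\Omega_0\subseteq\mathcal{D}$ compact. For $i=0,1,2,\dots$: (policy evaluation) take the value function $V^{\mu_i}\in\mathcal{C}^1(\Omega_i)$ of $\mu_i$, which satisfies $(\nabla V^{\mu_i}(x))^T(f(x)+g(x)\mu_i(x))=-r(x,\mu_i(x))$ for all $x\in\Omega_i$; (policy improvement) take $\mu_{i+1}:\mathcal{D}\to\mathbb{R}^m$ with $\mu_{i+1}(x)=-\frac12R^{-1}g^T(x)\nabla V^{\mu_i}(x)$ for all $x\in\Omega_i$; (region update) take the next region $\Omega_{i+1}$. Standing assumptions: (1) for any given policy $\mu$ (including all $\mu_i$), $f+g\mu$ is locally Lipschitz continuous on $\mathcal{D}$; (2) an admissible policy on some subset of $\mathcal{D}$ exists; (3) $V^*$ is the unique $\mathcal{C}^1$ positive definite solution of the HJB equation on a subset $\Omega^*\subseteq\mathcal{D}$; (4) for each $\mu_i\in\mathcal{A}(\Omega_i)$, $V^{\mu_i}\in\mathcal{C}^1(\Omega_i)$; (5) $\Omega_0\subseteq\Omega^*$ and, for all $i$, $(\Omega_{i+1},c_i)$ with $c_i>0$ is determined such that $\Omega_{i+1}=\bar\Omega_{c_i}^{\mu_i}$ and $\bar\Omega_{c_i}^{\mu_i}\subseteq\Omega_i$; that is, $\Omega_{i+1}\subseteq\Omega_i\subseteq\cdots\subseteq\Omega_0\subseteq\Omega^*\subseteq\mathcal{D}$. *)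

(* Defs.v *)
From mathcomp Require Export all_boot all_order all_algebra.
From mathcomp Require Export all_classical all_reals all_analysis.
Export Order.TTheory GRing.Theory Num.Theory.
Export numFieldNormedType.Exports.

Set Implicit Arguments.
Unset Strict Implicit.
Unset Printing Implicit Defensive.

Local Open Scope classical_set_scope.
Local Open Scope ring_scope.

Section Calculus.
Context {R : realType} {n : nat}.
Implicit Types (u v x : 'cV[R]_n) (V : 'cV[R]_n -> R) (Om : set 'cV[R]_n).

Definition dot u v : R := (u^T *m v) 0 0.

Definition posdef_mx (A : 'M[R]_n) : Prop :=
  A^T = A /\ forall u, u != 0 -> 0 < dot u (A *m u).

(* Subsets of the state space: a neighbourhood of the origin with no part
   isolated from the origin. *)
Definition region Om : Prop := nbhs (0 : 'cV[R]_n) Om /\ connected Om.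

Definition posdef_on Om V : Prop :=
  [/\ {within Om, continuous V}, V 0 = 0 &
      forall x, Om x -> x != 0 -> 0 < V x].

Definition grad V x : 'cV[R]_n := \col_i 'D_(delta_mx i 0) V x.

(* Differentiability is the full one, also at the points of Om that are not
   interior to Om; continuity of the gradient is relative to Om. *)
Definition C1_on Om V : Prop :=
  (forall x, Om x -> differentiable V x) /\ {within Om, continuous (grad V)}.

End Calculus.

(* The maps are total; their values outside dom never matter. *)
Record problem (R : realType) (n m : nat) := Problem {
  dom : set 'cV[R]_n ;
  drift : 'cV[R]_n -> 'cV[R]_n ;
  input : 'cV[R]_n -> 'M[R]_(n, m) ;
  state_cost : 'cV[R]_n -> R ;
  input_cost : 'M[R]_m
}.

Section Control.
Context {R : realType} {n m : nat} (P : problem R n m).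
Local Notation X := 'cV[R]_n.
Local Notation U := 'cV[R]_m.
Local Notation D := (dom P).
Local Notation f := (drift P).
Local Notation g := (input P).
Local Notation Q := (state_cost P).
Local Notation Ru := (input_cost P).
Implicit Types (mu : X -> U) (x : X) (t : R) (V W : X -> R) (Om : set X).

Record well_posed : Prop := WellPosed {
  wp_dom : region D ;
  wp_drift : [locally [lipschitz f x | x in D]] ;
  wp_drift0 : f 0 = 0 ;
  wp_input : [locally [lipschitz g x | x in D]] ;
  wp_state_cost : posdef_on D Q ;
  wp_input_cost : posdef_mx Ru
}.

Definition closed_loop mu x : X := f x + g x *m mu x.

Definition running_cost x (u : U) : R := Q x + dot u (Ru *m u).

Definition policy mu Om : Prop := {within Om, continuous mu} /\ mu 0 = 0.

Definition trajectory mu x (phi : R -> X) : Prop :=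
  [/\ phi 0 = x, {within `[0, +oo[, continuous phi},
      forall t, 0 <= t -> D (phi t) &
      forall t, 0 < t -> is_derive t 1 phi (closed_loop mu (phi t))].

Definition has_flow mu x : Prop := exists phi, trajectory mu x phi.

(* The trajectory from x on [0, +oo[, unspecified if there is none; it is
   unique when closed_loop mu is locally Lipschitz on D. *)
Definition flow mu x : R -> X := xget (cst x) [set phi | trajectory mu x phi].

Definition cost_along mu x t : R :=
  running_cost (flow mu x t) (mu (flow mu x t)).

(* V^mu is a partial function: value is meaningful only where value_exists. *)
Definition value_exists mu x : Prop :=
  has_flow mu x /\
  lebesgue_measure.-integrable `[0, +oo[ (fun t => (cost_along mu x t)%:E).

Definition value mu x : R :=
  \int[lebesgue_measure]_(t in `[0, +oo[) cost_along mu x t.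

(* Having a gradient at x requires V^mu to be defined near x. *)
Definition value_C1_on Om mu : Prop :=
  (forall x, Om x -> \forall y \near x, value_exists mu y) /\
  C1_on Om (value mu).

Definition sublevel mu (c : R) : set X :=
  [set x | value_exists mu x /\ value mu x <= c].

Definition stable mu : Prop :=
  forall e : R, 0 < e -> \forall x \near (0 : X),
    has_flow mu x /\ forall t, 0 <= t -> `|flow mu x t| < e.

Definition asymptotically_stabilizes mu Om : Prop :=
  [/\ forall x, Om x -> has_flow mu x, stable mu &
      forall x, Om x -> flow mu x t @[t --> +oo] --> (0 : X)].

Definition feasible mu Om : Prop :=
  forall x, Om x -> forall t, 0 <= t -> D (flow mu x t).

Definition admissible mu Om : Prop :=
  [/\ policy mu Om, asymptotically_stabilizes mu Om, feasible mu Om &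
      forall x, Om x -> value_exists mu x].

Definition improved V x : U :=
  - 2^-1 *: (invmx Ru *m (g x)^T *m grad V x).

Definition lyapunov mu Om : Prop := forall x, Om x ->
  dot (grad (value mu) x) (closed_loop mu x) = - running_cost x (mu x).

Definition HJB V Om : Prop := forall x, Om x ->
  0 = Q x + dot (grad V x) (f x)
      - 4^-1 * dot (grad V x) (g x *m invmx Ru *m (g x)^T *m grad V x).

Record optimal_solution (mustar : X -> U) (Omstar : set X) : Prop :=
  OptimalSolution {
  opt_region : region Omstar ;
  opt_dom : Omstar `<=` D ;
  opt_lipschitz : [locally [lipschitz (closed_loop mustar x) | x in D]] ;
  opt_policy : forall x, Omstar x -> mustar x = improved (value mustar) x ;
  opt_C1 : value_C1_on Omstar mustar ;
  opt_posdef : posdef_on Omstar (value mustar) ;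
  opt_HJB : HJB (value mustar) Omstar ;
  opt_unique : forall W, C1_on Omstar W -> posdef_on Omstar W ->
    HJB W Omstar -> forall x, Omstar x -> W x = value mustar x
}.

Record policy_iteration (Omstar : set X) (mu : nat -> X -> U)
    (Om : nat -> set X) (c : nat -> R) : Prop := PolicyIteration {
  pi_compact : compact (Om 0%N) ;
  pi_initial : admissible (mu 0%N) (Om 0%N) ;
  pi_Omstar : Om 0%N `<=` Omstar ;
  pi_region : forall i, region (Om i) ;
  pi_lipschitz : forall i, [locally [lipschitz (closed_loop (mu i) x) | x in D]] ;
  pi_C1 : forall i, value_C1_on (Om i) (mu i) ;
  pi_evaluation : forall i, lyapunov (mu i) (Om i) ;
  pi_improvement : forall i x, Om i x -> mu i.+1 x = improved (value (mu i)) x ;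
  pi_level : forall i, 0 < c i ;
  pi_update : forall i, Om i.+1 = sublevel (mu i) (c i) ;
  pi_nested : forall i, Om i.+1 `<=` Om i
}.

End Control.

(* Main.v *)
Require Import Defs.
From mathcomp Require Import ring lra.

(* Write V = V^{mu_k}, W = V^* and K = Omega_{k+1}.  The set K contains every
   point near it with a smaller value of V, so equality of two functions on K
   gives equality of their gradients on K, even at boundary points.  Hence V
   inherits the Lyapunov equation of mu_{k+1} and satisfies HJB on K, and
   completing the square gives mu_k = mu_{k+1}.
   HJB solutions are unique on Omega^* only, not on K, so V = W has to be proved
   on K itself.  Completing the square, V - W does not increase along mu_k and
   does not decrease along mu^*.  The mu_k-trajectories stay in K and approach
   0, whence W <= V.  The mu^*-trajectories may leave K: only those starting
   near 0 are known to stay.  So V = W holds near 0 first, and then extends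
   through the sublevel sets of V. *)

Local Open Scope classical_set_scope.
Local Open Scope ring_scope.

Set Implicit Arguments.
Unset Strict Implicit.
Unset Printing Implicit Defensive.

(** * Topology and one-variable calculus *)

Lemma within_continuous_image_comp (S T U : topologicalType) (A : set S)
    (B : set T) (f : S -> T) (g : T -> U) :
  (forall x, A x -> B (f x)) -> {within A, continuous f} ->
  {within B, continuous g} -> {within A, continuous (g \o f)}.
Proof.
move=> AB /subspace_continuousP fc /subspace_continuousP gc.
apply/subspace_continuousP => x Ax.
apply: cvg_trans (gc _ (AB _ Ax)) => W gW.
have := fc x Ax _ gW; rewrite /nbhs/= /within/=.
by apply: filterS => y + Ay => /(_ Ay); apply; exact: AB.
Qed.

Lemma locally_lipschitz_continuous (R : realType) (V W : normedModType R)
    (D : set V) (F : V -> W) :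
  [locally [lipschitz F x | x in D]] -> {within D, continuous F}.
Proof.
move=> lipF; apply/subspace_continuousP => x Dx.
have /(_ (conj Dx Dx)) := lipF (x, x).
rewrite /lipschitz_on => lip.
have [M [/= M0 {lip}]] : exists M : R, 0 < M /\ (\forall p \near (x, x),
    D p.1 /\ D p.2 -> `|F p.1 - F p.2| <= M * `|p.1 - p.2|).
  have [M [M0 lipM]] :=
    filter_ex (filterI (nbhs_pinfty_gt (num_real (0 : R))) lip).
  by exists M.
move=> [[A B] /= [Ax Bx] AB].
apply/cvgrPdist_lt => e e0; rewrite near_withinE; near=> y => Dy.
apply: (@le_lt_trans _ _ (M * `|x - y|)).
  apply: (AB (x, y)) => //=; split; first exact: nbhs_singleton Ax.
  by near: y.
rewrite mulrC -ltr_pdivlMr//; near: y.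
by apply: cvgr_dist_lt; [exact: cvg_id|exact: divr_gt0].
Unshelve. all: by end_near. Qed.

(** Let m be the infimum of the counterexamples. The property holds below m, hence at m by the
    left-limit hypothesis, hence slightly beyond m by the right one, which is absurd. *)
Lemma real_induction (R : realType) (P : R -> Prop) (a b : R) :
  P a ->
  (forall t, a <= t < b -> (forall s, a <= s <= t -> P s) ->
    \forall s \near t^'+, P s) ->
  (forall t, a < t <= b -> (forall s, a <= s < t -> P s) -> P t) ->
  forall t, a <= t <= b -> P t.
Proof.
move=> Pa Pright Pleft t tab; apply: contrapT => nPt.
pose S := [set s | a <= s <= b /\ ~ P s]; set m := inf S.
have St : S t by [].
have Slb : lbound S a by move=> s [/andP[]].
have Sinf : has_inf S by split; [exists t|exists a].
have am : a <= m by apply: lb_le_inf => //; exists t.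
have mt : m <= t by apply: ge_inf => //; exists a.
have mb : m <= b by move/andP: tab => [_]; apply: le_trans.
have Plt s : a <= s < m -> P s.
  move=> /andP[as_ sm]; apply: contrapT => nPs.
  suff : m <= s by rewrite leNgt sm.
  apply: ge_inf; [by exists a|split=> //].
  by rewrite as_ (le_trans (ltW sm)).
have Pm : P m.
  have [->//|am'] := eqVneq m a; apply: Pleft => //.
  by rewrite lt_neqAle eq_sym am' am.
have mltt : m < t.
  by rewrite lt_neqAle mt andbT; apply/eqP => mE; apply: nPt; rewrite -mE.
have Ple s : a <= s <= m -> P s.
  move=> /andP[as_]; rewrite le_eqVlt => /orP[/eqP->//|sm].
  by apply: Plt; rewrite as_.
have [|e /= e0 He] := Pright m _ Ple.
  by rewrite am (lt_le_trans mltt)//; case/andP: tab.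
have [s Ss sme] := inf_adherent e0 Sinf.
case: Ss => /andP[as_ sb] nPs; apply: nPs.
have [sm|ms] := leP s m; first by apply: Ple; rewrite as_.
rewrite -/m in sme.
by apply: He => //=; rewrite ltr_norml; apply/andP; split; lra.
Qed.

Lemma closed_left_limit (R : realType) (T : topologicalType) (S : set T)
    (psi : R -> T) (a t : R) : closed S -> {for t, continuous psi} -> a < t ->
  (forall s, a <= s < t -> S (psi s)) -> S (psi t).
Proof.
move=> Scl ct at_ Hs; apply: contrapT => nSt.
have : \forall s \near t, (~` S) (psi s).
  by apply: ct; apply: open_nbhs_nbhs; split => //; exact: closed_openC.
move=> [e /= e0 He].
pose s := Num.max a (t - e / 2).
have st : s < t by rewrite gt_max at_/=; lra.
apply: (He s); last by apply: Hs; rewrite st andbT le_max lexx.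
have : t - e / 2 <= s by rewrite le_max lexx orbT.
by move=> sge /=; rewrite ltr_norml; apply/andP; split; lra.
Qed.

Lemma closed_invariant (R : realType) (T : topologicalType) (S : set T)
    (psi : R -> T) :
  closed S -> (forall t, 0 <= t -> {for t, continuous psi}) -> S (psi 0) ->
  (forall t, 0 <= t -> S (psi t) -> \forall s \near t^'+, S (psi s)) ->
  forall t, 0 <= t -> S (psi t).
Proof.
move=> Scl cpsi S0 Sr t t0.
apply: (@real_induction R (S \o psi) 0 t) => /=.
- by [].
- by move=> s /andP[s0 st] /(_ s); rewrite s0 lexx => /(_ isT); exact: Sr.
- move=> s /andP[s0 st]; apply: closed_left_limit => //.
  by apply: cpsi; exact: ltW.
- by rewrite t0 lexx.
Qed.

Lemma is_derive_continuous (R : realType) (W : normedModType R) (f : R -> W)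
    (t : R) (df : W) : is_derive t 1 f df -> {for t, continuous f}.
Proof.
by move=> [fd _]; apply: differentiable_continuous; apply/derivable1_diffP.
Qed.

Lemma mean_value_le (R : realType) (f df : R -> R) (a b k : R) : a <= b ->
  (forall t, a <= t <= b -> is_derive t 1 f (df t)) ->
  (forall t, a <= t <= b -> df t <= k) ->
  f b - f a <= k * (b - a).
Proof.
move=> ab fd dfk.
have [||c /= cab ->] := @MVT_segment R f df a b ab.
- move=> t tab; apply: fd.
  by rewrite in_itv/= in tab; case/andP: tab => /ltW -> /ltW ->.
- apply: derivable_within_continuous => t; rewrite in_itv/= => tab.
  by have [] := fd t tab.
by apply: ler_wpM2r; rewrite ?subr_ge0//; apply: dfk; rewrite in_itv/= in cab.
Qed.

Lemma is_derive_lt0_right (R : realType) (f : R -> R) (t d : R) :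
  is_derive t 1 f d -> d < 0 -> \forall s \near t^'+, f s < f t.
Proof.
move=> [fd <-] d0.
have : h^-1 *: (f (h *: 1 + t) - f t) @[h --> 0^'] --> 'D_1 f t by [].
move=> /cvgr_lt/(_ _ d0); rewrite /dnbhs /within/= => -[e /= e0 He].
exists e => //= s ste ts.
have := He (s - t); rewrite /= sub0r normrN distrC => /(_ ste).
rewrite subr_eq0 gt_eqF// => /(_ isT).
rewrite [_%:A]mulr1 subrK.
rewrite [_ *: _]mulrC pmulr_llt0 ?invr_gt0 ?subr_gt0//.
by rewrite subr_lt0.
Qed.

Lemma mx_entry_norm_le (R : realType) (m n : nat) (A : 'M[R]_(m, n)) i j :
  `|A i j| <= `|A|.
Proof. by rewrite {2}/Num.norm/= mx_normrE; exact: (le_bigmax _ _ (i, j)). Qed.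

Lemma is_derive_mx_entry (R : realType) (m n : nat) (psi : R -> 'M[R]_(m, n))
    (t : R) (w : 'M[R]_(m, n)) i j :
  is_derive t 1 psi w -> is_derive t 1 (fun s => psi s i j) (w i j).
Proof.
move=> [psid <-]; apply: DeriveDef; first exact: (derivable_mxP psi t 1).1.
by rewrite derive_mx// mxE.
Qed.

(** The mean value theorem is applied entry by entry, since the norm is the largest absolute value
    of an entry. *)
Lemma mean_value_norm_le (R : realType) (m n : nat)
    (psi dpsi : R -> 'M[R]_(m, n)) (a b M : R) : a <= b ->
  {within `[a, b], continuous psi} ->
  (forall t, a < t < b -> is_derive t 1 psi (dpsi t)) ->
  (forall t, a < t < b -> `|dpsi t| <= M) ->
  `|psi b - psi a| <= M * (b - a).
Proof.
rewrite le_eqVlt => /orP[/eqP->|ab] cpsi psid dpsiM.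
  by rewrite !subrr normr0 mulr0.
have M0 : 0 <= M.
  by apply: (le_trans (normr_ge0 (dpsi ((a + b) / 2)))); apply: dpsiM; lra.
rewrite {1}/Num.norm/= mx_normrE; apply: bigmax_le => [|[i j] _ /=].
  by rewrite mulr_ge0// subr_ge0 ltW.
rewrite !mxE.
have [||c] := @MVT R (fun t => psi t i j) (fun t => dpsi t i j) a b ab.
- move=> t; rewrite in_itv/= => tab.
  by apply: is_derive_mx_entry; exact: psid.
- apply: (@within_continuous_image_comp _ _ _ _ setT _
    (fun A : 'M[R]_(m, n) => A i j)) => //.
  by apply: continuous_subspaceT => A; exact: coord_continuous.
rewrite in_itv/= => cab ->; rewrite normrM (@ger0_norm _ (b - a)).
  apply: ler_wpM2r; first by rewrite subr_ge0 ltW.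
  by apply: le_trans (dpsiM c cab); exact: mx_entry_norm_le.
by rewrite subr_ge0 ltW.
Qed.

(** Continuity gives the value at 0. A nonzero derivative would push f or -f strictly below 0 just
    to the right of 0. *)
Lemma right_zero_derive (R : realType) (f : R -> R) (d : R) :
  is_derive (0 : R) 1 f d ->
  (\forall s \near 0^'+, f s = 0) -> f 0 = 0 /\ d = 0.
Proof.
move=> fd f0.
have f00 : f 0 = 0.
  have c1 : f s @[s --> 0^'+] --> f 0.
    exact: cvg_at_right_filter (is_derive_continuous fd).
  have c2 : f s @[s --> 0^'+] --> (0 : R) by exact: cvg_near_cst.
  exact: (cvg_unique _ c1 c2).
split=> //; apply/eqP; rewrite eq_le leNgt [X in _ && X]leNgt.
apply/andP; split; apply/negP => d0.
  have fdN : is_derive (0 : R) 1 (- f) (- d) by exact: is_deriveN.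
  have /(is_derive_lt0_right fdN) fN : - d < 0 by rewrite oppr_lt0.
  have [s [fs0 +]] : exists s, f s = 0 /\ - f s < - f 0.
    by apply: (@filter_ex _ (0^'+)); apply: filterI f0 fN.
  by rewrite fs0 f00 ltxx.
have [s [fs0 +]] : exists s, f s = 0 /\ f s < f 0.
  apply: (@filter_ex _ (0^'+)).
  exact: filterI f0 (is_derive_lt0_right fd d0).
by rewrite fs0 f00 ltxx.
Qed.

(** * Dot product and positive definite matrices *)

Section DotProduct.
Context {R : realType} {n : nat}.
Implicit Types (u v w : 'cV[R]_n) (A : 'M[R]_n).

Lemma dotC u v : dot u v = dot v u.
Proof. by rewrite /dot -[in LHS](trmxK v) -trmx_mul mxE. Qed.

Lemma dotD u v w : dot u (v + w) = dot u v + dot u w.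
Proof. by rewrite /dot mulmxDr mxE. Qed.

Lemma dotB u v w : dot u (v - w) = dot u v - dot u w.
Proof. by rewrite /dot mulmxBr !mxE. Qed.

Lemma dotDl u v w : dot (u + v) w = dot u w + dot v w.
Proof. by rewrite dotC dotD !(dotC w). Qed.

Lemma dotZr (a : R) u v : dot u (a *: v) = a * dot u v.
Proof. by rewrite /dot -scalemxAr mxE. Qed.

Lemma dotZl (a : R) u v : dot (a *: u) v = a * dot u v.
Proof. by rewrite dotC dotZr dotC. Qed.

Lemma dot_mulmx (p : nat) (B : 'M[R]_(n, p)) u (v : 'cV[R]_p) :
  dot u (B *m v) = dot (B^T *m u) v.
Proof. by rewrite /dot trmx_mul trmxK mulmxA. Qed.

Lemma posdef_ge0 A u : posdef_mx A -> 0 <= dot u (A *m u).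
Proof.
move=> [_ Apos]; have [->|u0] := eqVneq u 0; last exact/ltW/Apos.
by rewrite /dot mulmx0 mulmx0 mxE.
Qed.

Lemma posdef_eq0 A u : posdef_mx A -> dot u (A *m u) = 0 -> u = 0.
Proof.
move=> [_ Apos] Au; apply/eqP/negPn/negP => /Apos.
by rewrite Au ltxx.
Qed.

Lemma posdef_unitmx A : posdef_mx A -> A \in unitmx.
Proof.
move=> [Asym Apos]; rewrite unitmxE unitfE; apply/negP => /det0P[v v0 vA].
have := Apos v^T; rewrite -(inj_eq trmx_inj) trmxK trmx0 => /(_ v0).
by rewrite /dot trmxK mulmxA vA mul0mx mxE ltxx.
Qed.

End DotProduct.

(** * Gradients and derivatives along curves *)

Section Gradient.
Context {R : realType} {n : nat}.
Local Notation X := 'cV[R]_n.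
Implicit Types (V W : X -> R) (x v w : X) (psi : R -> X).

Lemma dot_gradE V x v : differentiable V x -> dot (grad V x) v = 'd V x v.
Proof.
move=> Vd; rewrite /dot mxE.
have {2}-> : v = \sum_i v i 0 *: delta_mx i 0.
  by rewrite {1}[v]matrix_sum_delta; apply: eq_bigr => i _; rewrite big_ord1.
rewrite linear_sum; apply: eq_bigr => i _.
by rewrite !mxE linearZ/= deriveE// mulrC.
Qed.

Lemma is_derive_along V psi t w : differentiable V (psi t) ->
  is_derive t 1 psi w -> is_derive t 1 (V \o psi) (dot (grad V (psi t)) w).
Proof.
move=> Vd [psid <-].
have psidd : differentiable psi t by exact/derivable1_diffP.
apply: DeriveDef.
  by apply/derivable1_diffP; exact: differentiable_comp.
rewrite deriveE; last exact: differentiable_comp.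
by rewrite diff_comp//= dot_gradE// (deriveE _ psidd).
Qed.

Lemma is_derive_line x v (t : R) : is_derive t 1 (fun s => x + s *: v) v.
Proof.
have line : h^-1 *: ((x + (h *: (1 : R) + t) *: v) - (x + t *: v))
    @[h --> 0^'] --> v.
  apply: cvg_near_cst; near=> h.
  rewrite opprD addrACA subrr add0r -scalerBl addrK scalerA [_%:A]mulr1.
  by rewrite mulVf ?scale1r//; near: h; exact: nbhs_dnbhs_neq.
by apply: DeriveDef; [exact: cvgP line|exact: cvg_lim line].
Unshelve. all: by end_near. Qed.

(* [V] and [W] agree on an open half space of directions at [x], and such
   directions span. *)
Lemma eq_grad_of_eq_sublevel V W x v :
  differentiable V x -> differentiable W x -> dot (grad V x) v < 0 ->
  (\forall y \near x, V y < V x -> V y = W y) ->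
  V x = W x /\ grad V x = grad W x.
Proof.
move=> Vd Wd Vv VW.
have line0 w : is_derive (0 : R) 1 (fun s => x + s *: w) w.
  exact: is_derive_line.
have dline U w : differentiable U x ->
    is_derive (0 : R) 1 (U \o (fun s => x + s *: w)) (dot (grad U x) w).
  move=> Ud; have := @is_derive_along U (fun s => x + s *: w) 0 w.
  by rewrite scale0r addr0; apply.
(* Moving from x in a direction w of strict descent lowers V, so V - W vanishes just after time 0 on
   that line and [right_zero_derive] applies. *)
have half w : dot (grad V x) w < 0 ->
    V x = W x /\ dot (grad V x) w = dot (grad W x) w.
  move=> Vw.
  have near_line : \forall s \near (0 : R), V (x + s *: w) < V x ->
      V (x + s *: w) = W (x + s *: w).
    have cl : x + s *: w @[s --> (0 : R)] --> x.
      have := is_derive_continuous (line0 w).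
      by rewrite /prop_for /continuous_at /= scale0r addr0.
    exact: cl VW.
  have VWr : \forall s \near (0 : R)^'+,
      ((V \o (fun s => x + s *: w)) - (W \o (fun s => x + s *: w))) s = 0.
    have Vlt : \forall s \near (0 : R)^'+, V (x + s *: w) < V x.
      have := is_derive_lt0_right (dline V w Vd) Vw.
      by rewrite /= scale0r addr0.
    have VWlt : \forall s \near (0 : R)^'+, V (x + s *: w) < V x ->
        V (x + s *: w) = W (x + s *: w) by exact: cvg_within near_line.
    near=> s.
    have VWs : V (x + s *: w) = W (x + s *: w).
      by apply: (near VWlt s) => //; exact: (near Vlt s).
    by apply/eqP; rewrite subr_eq0; exact/eqP.
  have [] := right_zero_derive (is_deriveB (dline V w Vd) (dline W w Wd)) VWr.
  rewrite -[(_ - _) 0]/(V (x + 0 *: w) - W (x + 0 *: w)) scale0r addr0.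
  by move=> /subr0_eq-> /subr0_eq.
have [VWx dv] := half _ Vv; split=> //.
have dVW w : dot (grad V x) w = dot (grad W x) w.
  (* One of v + w and v - w is again a direction of descent, and v itself is settled. *)
  have [Vw|Vw] := leP (dot (grad V x) w) 0.
    have [|_] := half (v + w); first by rewrite dotD; lra.
    by rewrite !dotD; lra.
  have [|_] := half (v - w); first by rewrite dotB; lra.
  by rewrite !dotB; lra.
apply/colP => i; rewrite !mxE.
by have := dVW (delta_mx i 0); rewrite !dot_gradE// !deriveE.
Unshelve. all: by end_near. Qed.

End Gradient.

(** * Integral curves and Lyapunov functions *)

Section Curves.
Context {R : realType} {n : nat}.
Local Notation X := 'cV[R]_n.
Implicit Types (V W Q : X -> R) (x v w : X) (psi phi : R -> X) (F : X -> X).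

(** Subtract the line of slope [dphi 0]: for small h the difference has derivative at most e in norm
    between 0 and h, so it changes by at most e h. *)
Lemma right_derivative_of_cvg (phi dphi : R -> X) :
  {within `[0, +oo[, continuous phi} ->
  dphi t @[t --> 0^'+] --> dphi 0 ->
  (forall t : R, 0 < t -> is_derive t 1 phi (dphi t)) ->
  h^-1 *: (phi h - phi 0) @[h --> 0^'+] --> dphi 0.
Proof.
move=> cphi cdphi dphiE; apply/cvgrPdist_le => e e0.
move/cvgrPdist_le : cdphi => /(_ _ e0) [d /= d0 Hd].
exists d => //= h hd h0.
set w := dphi 0.
pose line s := phi 0 + s *: w.
have hdlt : h < d by move: hd; rewrite /= sub0r normrN gtr0_norm.
have cpl : {within `[0, h], continuous (phi - line)}.
  apply/subspace_continuousP => t th; apply: cvgB.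
    have /subspace_continuousP := cphi.
    move=> /(_ t) ct; apply: cvg_trans (ct _).
      apply: cvg_app; apply: within_subset.
      by move=> s /=; rewrite !in_itv/= => /andP[->].
    by move: th; rewrite /= !in_itv/= => /andP[->].
  apply: cvg_within_filter.
  exact: (is_derive_continuous (is_derive_line (phi 0) w t)).
have dpl t : 0 < t < h -> is_derive t 1 (phi - line) (dphi t - w).
  move=> /andP[t0 th]; apply: is_deriveB; first exact: dphiE.
  exact: is_derive_line.
have bpl t : 0 < t < h -> `|dphi t - w| <= e.
  move=> /andP[t0 th]; rewrite distrC; apply: Hd => //=.
  by rewrite sub0r normrN gtr0_norm// (lt_trans th).
have := mean_value_norm_le (ltW h0) cpl dpl bpl.
rewrite -[(_ - _) h]/(phi h - line h) -[(_ - _) 0]/(phi 0 - line 0).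
rewrite /line scale0r addr0 subrr !subr0 => He.
rewrite distrC -(ler_pM2l h0) -[X in X * _](gtr0_norm h0) -normrZ.
rewrite scalerBr scalerA divff ?gt_eqF// scale1r.
by rewrite -addrA -opprD mulrC.
Qed.

(** Trajectories have a prescribed derivative for t > 0 only. Continuing one by its tangent line to
    t < 0 makes the derivative at 0 two-sided, so time 0 needs no separate treatment later. *)
Lemma extend_curve (phi dphi : R -> X) :
  {within `[0, +oo[, continuous phi} ->
  dphi t @[t --> 0^'+] --> dphi 0 ->
  (forall t : R, 0 < t -> is_derive t 1 phi (dphi t)) ->
  exists psi, (forall t, 0 <= t -> psi t = phi t) /\
    forall t : R, 0 <= t -> is_derive t 1 psi (dphi t).
Proof.
move=> cphi cdphi dphiE.
pose psi t := if t < 0 then phi 0 + t *: dphi 0 else phi t.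
have psiE t : 0 <= t -> psi t = phi t by rewrite /psi leNgt => /negbTE ->.
exists psi; split=> // t; rewrite le_eqVlt => /orP[/eqP<-|t0]; last first.
  apply: (near_eq_is_derive _ (dphiE _ t0)).
  by near=> s; rewrite psiE// ltW//; near: s; exact: lt_nbhsr.
have right := right_derivative_of_cvg cphi cdphi dphiE.
have slope : h^-1 *: (psi (h *: (1 : R) + 0) - psi 0) @[h --> 0^'] --> dphi 0.
  apply/cvgrPdist_le => e e0.
  move/cvgrPdist_le : right => /(_ _ e0) [d /= d0 Hd].
  exists d => //= h hd h0; rewrite addr0 [_%:A]mulr1 (psiE 0)//.
  have [hneg|hpos] := ltP h 0.
    rewrite /psi hneg addrAC subrr add0r scalerA mulVf// scale1r subrr normr0.
    exact: ltW.
  by rewrite psiE//; apply: Hd => //; rewrite lt_neqAle eq_sym h0.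
by apply: DeriveDef; [exact: cvgP slope|exact: cvg_lim slope].
Unshelve. all: by end_near. Qed.

(* [V] is a Lyapunov function, so [Q] cannot stay away from [0] along the
   curve. *)
Lemma curve_meets_nbhs0 (K : set 'cV[R]_n) V Q F psi : compact K ->
  {within K, continuous Q} -> (forall x, K x -> x != 0 -> 0 < Q x) ->
  (forall x, K x -> differentiable V x) ->
  (forall x, K x -> dot (grad V x) (F x) <= - Q x) ->
  (forall x, K x -> 0 <= V x) ->
  (forall t : R, 0 <= t -> is_derive t 1 psi (F (psi t))) ->
  (forall t : R, 0 <= t -> K (psi t)) ->
  forall (N : set 'cV[R]_n) (T : R), nbhs (0 : X) N -> 0 <= T ->
  exists2 t, T <= t & N (psi t).
Proof.
move=> Kc Qc Qpos Vd VQ V0 dpsi Kpsi N T N0 T0; apply: contrapT => noN.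
have notN t : T <= t -> ~ N (psi t) by move=> Tt Nt; apply: noN; exists t.
pose K' := K `&` ~` N°.
have K'c : compact K'.
  by apply: compact_closedI => //; apply: open_closedC; exact: open_interior.
have K'psi t : T <= t -> K' (psi t).
  move=> Tt; split; first by apply: Kpsi; exact: le_trans Tt.
  by move=> /interior_subset; exact: notN.
have [||y] := compact_EVT_min (f := Q) _ K'c.
- by exists (psi T); exact: K'psi.
- by apply: continuous_subspaceW Qc => x [].
rewrite inE => -[Ky Ny] Qmin.
have q0 : 0 < Q y.
  by apply: Qpos => //; apply: contra_not_neq Ny => ->; exact: N0.
have descent t : T <= t -> V (psi t) - V (psi T) <= - Q y * (t - T).
  move=> Tt; apply: (@mean_value_le R (V \o psi)
    (fun t => dot (grad V (psi t)) (F (psi t)))) => // s /andP[Ts _].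
  - apply: is_derive_along; last by apply: dpsi; exact: le_trans Ts.
    by apply: Vd; apply: Kpsi; exact: le_trans Ts.
  - apply: le_trans (VQ _ (Kpsi _ (le_trans T0 Ts))) _.
    by rewrite lerN2; apply: Qmin; rewrite inE; exact: K'psi.
have VT0 := V0 _ (Kpsi _ T0).
(* By this time the decrease is at least V (psi T) + Q y, which would make V negative. *)
pose t := T + (V (psi T) / Q y + 1).
have Tt : T <= t by rewrite lerDl addr_ge0// divr_ge0// ltW.
have := descent _ Tt; rewrite /t addrAC subrr add0r -/t.
rewrite mulNr mulrDr mulr1 mulrCA divff ?gt_eqF// mulr1.
by have := V0 _ (Kpsi _ (le_trans T0 Tt)); lra.
Qed.

(** V - W does not increase along the curve and is within e of 0 when the curve is near the origin,
    which happens by [curve_meets_nbhs0]. So V - W is above -e at the start. *)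
Lemma lyapunov_comparison (K : set 'cV[R]_n) V W Q F psi :
  compact K -> nbhs (0 : X) K ->
  {within K, continuous Q} -> (forall x, K x -> x != 0 -> 0 < Q x) ->
  (forall x, K x -> differentiable V x) ->
  (forall x, K x -> differentiable W x) ->
  (forall x, K x -> dot (grad V x) (F x) <= - Q x) ->
  (forall x, K x -> dot (grad V x) (F x) <= dot (grad W x) (F x)) ->
  (forall x, K x -> 0 <= V x) -> V 0 = W 0 ->
  (forall t : R, 0 <= t -> is_derive t 1 psi (F (psi t))) ->
  (forall t : R, 0 <= t -> K (psi t)) ->
  W (psi 0) <= V (psi 0).
Proof.
move=> Kc K0 Qc Qpos Vd Wd VQ VW V0 VW0 dpsi Kpsi.
apply/ler_addgt0Pl => e e0.
have K00 := nbhs_singleton K0.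
have cVW : (V - W) x @[x --> (0 : X)] --> (V - W) 0.
  apply: differentiable_continuous.
  exact: differentiableB (Vd _ K00) (Wd _ K00).
move/cvgrPdist_lt : cVW => small.
have [t t0] := curve_meets_nbhs0 Kc Qc Qpos Vd VQ V0 dpsi Kpsi
  (small _ e0) (lexx 0).
rewrite -[(V - W) 0]/(V 0 - W 0) -[(V - W) (psi t)]/(V (psi t) - W (psi t)).
rewrite VW0 subrr sub0r normrN => {}small.
have := @mean_value_le R ((V \o psi) - (W \o psi))
  (fun t => dot (grad V (psi t)) (F (psi t)) - dot (grad W (psi t)) (F (psi t)))
  0 t 0 t0.
move=> /(_ _)/wrap[].
  move=> s /andP[s0 _]; apply: is_deriveB; apply: is_derive_along.
  - by apply: Vd; exact: Kpsi.
  - exact: dpsi.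
  - by apply: Wd; exact: Kpsi.
  - exact: dpsi.
move=> /(_ _)/wrap[].
  by move=> s /andP[s0 _]; rewrite subr_le0; apply: VW; exact: Kpsi.
rewrite -[(_ - _) t]/(V (psi t) - W (psi t)).
rewrite -[(_ - _) 0]/(V (psi 0) - W (psi 0)) mul0r.
by move: small; rewrite ltr_norml => /andP[]; lra.
Qed.

End Curves.

(** * Continuity facts for the comparison argument *)

Lemma closed_sublevel (R : realType) (T : topologicalType) (A : set T)
    (f : T -> R) (c : R) : closed A ->
  (forall x, A x -> {for x, continuous f}) ->
  closed [set x | A x /\ f x <= c].
Proof.
move=> Acl fc x clx.
have Ax : A x by apply: Acl; apply: closureS clx => y [].
split=> //; rewrite leNgt; apply/negP => cfx.
have [y [[_ fyc] cfy]] := clx _ (cvgr_gt _ (fc x Ax) _ cfx).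
by move: cfy; rewrite ltNge fyc.
Qed.

Lemma cvg_dot (R : realType) (n : nat) (T : Type) (F : set_system T)
    (FF : Filter F) (u v : T -> 'cV[R]_n) (a b : 'cV[R]_n) :
  u @ F --> a -> v @ F --> b -> dot (u x) (v x) @[x --> F] --> dot a b.
Proof.
move=> ua vb; rewrite /dot mxE.
have -> : (fun x => ((u x)^T *m v x) 0 0) =
    fun x => \sum_i (u x) i 0 * (v x) i 0.
  by apply/funext => x; rewrite mxE; apply: eq_bigr => i _; rewrite mxE.
apply: (cvg_big (op := +%R)) => [|i _]; first exact: add_continuous.
rewrite mxE; apply: cvgM.
- apply: (cvg_comp u (fun M : 'cV[R]_n => M i 0) ua).
  exact: coord_continuous.
- apply: (cvg_comp v (fun M : 'cV[R]_n => M i 0) vb).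
  exact: coord_continuous.
Qed.

Lemma dist_continuous (R : realType) (V : normedModType R) (z : V) :
  continuous (fun w : V => `|z - w|).
Proof.
move=> w; apply: (@cvg_norm _ _ _ _ _ (fun w => z - w)).
by apply: cvgB; [exact: cvg_cst|exact: cvg_id].
Qed.

(** * Comparison of two Lyapunov functions on a compact set *)

Section Comparison.
Context {R : realType} {n : nat}.
Local Notation X := 'cV[R]_n.
Implicit Types (V W Q : X -> R) (x y v w : X) (psi : R -> X) (F : X -> X)
  (K D : set X).

(** Unlike in [trajectory], the derivative is required at t = 0 too, and is two-sided there. *)
Definition integral_curve F psi : Prop :=
  forall t : R, 0 <= t -> is_derive t 1 psi (F (psi t)).

Definition has_curves D K F : Prop := forall x, K x ->
  exists psi, [/\ psi 0 = x, integral_curve F psi &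
                  forall t : R, 0 <= t -> D (psi t)].

(** What the comparison uses of a sublevel set of V: even at a boundary point of K, small moves that
    lower V remain in K. *)
Definition absorbs_sublevels K V : Prop :=
  forall x, K x -> \forall y \near x, V y < V x -> K y.

(** Away from 0 the curve moves at once to smaller values of V, hence within K; at 0 there is a
    whole neighbourhood inside K. *)
Lemma absorbing_invariant K V F psi : closed K -> nbhs (0 : X) K ->
  absorbs_sublevels K V -> (forall x, K x -> differentiable V x) ->
  (forall x, K x -> x != 0 -> dot (grad V x) (F x) < 0) ->
  integral_curve F psi -> K (psi 0) -> forall t : R, 0 <= t -> K (psi t).
Proof.
move=> Kcl K0 Kabs Vd VF cpsi K1.
have cont (t : R) : 0 <= t -> psi s @[s --> t] --> psi t.
  by move=> t0; apply: is_derive_continuous; exact: cpsi.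
apply: closed_invariant => // t t0 Kt.
have [psi0|psi0] := eqVneq (psi t) 0.
  by apply: cvg_within; apply: cont => //; rewrite psi0.
have Vlt : \forall s \near t^'+, V (psi s) < V (psi t).
  apply: is_derive_lt0_right (VF _ Kt psi0).
  by apply: is_derive_along (cpsi _ t0); exact: Vd.
have Knear : \forall s \near t^'+, V (psi s) < V (psi t) -> K (psi s).
  by apply: cvg_within; exact: (cont _ t0 _ (Kabs _ Kt)).
by apply: filterS2 Vlt Knear => s Vs; exact.
Qed.


Section TwoLyapunovFunctions.
(** In the application F and G are the closed loops of mu_k and mu^*, with value functions V and W.
    K absorbs sublevel sets of V, so F-curves stay in K while G-curves may leave it. *)
Context (D K : set X) (Q V W : X -> R) (F G : X -> X).
Hypotheses (Kc : compact K) (K0 : nbhs (0 : X) K) (KD : K `<=` D).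
Hypotheses (Qc : {within K, continuous Q})
  (Qpos : forall x, K x -> x != 0 -> 0 < Q x).
Hypotheses (Vd : forall x, K x -> differentiable V x)
  (gVc : {within K, continuous (grad V)}) (Vabs : absorbs_sublevels K V)
  (V_ge0 : forall x, K x -> 0 <= V x) (V00 : V 0 = 0).
Hypotheses (Wd : forall x, K x -> differentiable W x) (W00 : W 0 = 0)
  (Wpos : forall x, K x -> x != 0 -> 0 < W x).
Hypotheses (Fcurves : has_curves D K F) (Gcurves : has_curves D K G)
  (Gc : {within D, continuous G}).
Hypotheses (VF : forall x, K x -> dot (grad V x) (F x) <= - Q x)
  (VWF : forall x, K x -> dot (grad V x) (F x) <= dot (grad W x) (F x))
  (WG : forall x, K x -> dot (grad W x) (G x) <= - Q x)
  (WVG : forall x, K x -> dot (grad W x) (G x) <= dot (grad V x) (G x)).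

Let Kcl : closed K.
Proof. by apply: compact_closed Kc; exact: norm_hausdorff. Qed.

Lemma comparison_le x : K x -> W x <= V x.
Proof.
move=> Kx; have [psi [psi0 cpsi _]] := Fcurves Kx; rewrite -psi0 in Kx *.
apply: (lyapunov_comparison Kc K0 Qc Qpos Vd Wd VF VWF V_ge0 _ cpsi).
  by rewrite V00 W00.
apply: (absorbing_invariant Kcl K0 Vabs Vd _ cpsi) => // y Ky y0.
by apply: le_lt_trans (VF Ky) _; rewrite oppr_lt0; exact: Qpos.
Qed.

Let W_ge0 x : K x -> 0 <= W x.
Proof.
by move=> Kx; have [->|x0] := eqVneq x 0; [rewrite W00|exact/ltW/Wpos].
Qed.

(** The classical stability argument for W under G: a curve starting close to 0, with W below its
    minimum m on a small sphere, cannot reach that sphere. It stays in K, and [lyapunov_comparison]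
    applies with V and W exchanged. *)
Lemma comparison_ge_near0 : \forall x \near (0 : X), V x <= W x.
Proof.
have [r /= r0 rK] : exists2 r : R, 0 < r & forall x, `|x| <= r -> K x.
  have [r /= r0 rK] := (nbhs_normP _ _).1 K0.
  exists (r / 2) => [|x xr]; first exact: divr_gt0.
  by apply: rK; rewrite /= sub0r normrN; lra.
pose B := K `&` [set x | `|x| <= r].
have Bcl : closed B.
  apply: closedI => //.
  apply: (@closed_comp _ _ (fun x : X => `|x|) [set s | s <= r]) => [x _|].
    exact: norm_continuous.
  exact: closed_le.
pose S := K `&` [set x | `|x| = r].
have [m m0 mW] : exists2 m, 0 < m & forall x, S x -> m <= W x.
  (* The sphere is empty when n = 0; any positive m then serves. *)
  have [[x0 Sx0]|noS] := pselect (S !=set0); last first.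
    by exists 1 => // x Sx; case: noS; exists x.
  have Sc : compact S.
    apply: compact_closedI => //.
    apply: (@closed_comp _ _ (fun x : X => `|x|) [set s | s = r]) => [x _|].
      exact: norm_continuous.
    exact: closed_eq.
  have [||y] := compact_EVT_min (f := W) _ Sc; first by exists x0.
    apply: continuous_in_subspaceT => x; rewrite inE => -[Kx _].
    exact: differentiable_continuous (Wd Kx).
  rewrite inE => -[Ky yr] Wmin; exists (W y).
    by apply: Wpos => //; rewrite -normr_gt0 yr.
  by move=> x Sx; apply: Wmin; rewrite inE.
have Wc0 : W x @[x --> (0 : X)] --> W 0.
  exact: differentiable_continuous (Wd (nbhs_singleton K0)).
have Wm : \forall x \near (0 : X), W x < m.
  by apply: (cvgr_lt _ Wc0); rewrite W00.
have near_r : \forall x \near (0 : X), `|x| < r.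
  by apply/nbhs_normP; exists r => //= x; rewrite /= sub0r normrN.
near=> x.
have Wxm : W x < m by near: x.
have xr : `|x| < r by near: x.
have Kx : K x by apply: rK; exact: ltW.
have [->|x0] := eqVneq x 0; first by rewrite V00 W00.
have [psi [psi0 cpsi _]] := Gcurves Kx.
have cont (t : R) : 0 <= t -> psi s @[s --> t] --> psi t.
  by move=> t0; apply: is_derive_continuous; exact: cpsi.
have BW : forall t, 0 <= t -> B (psi t) /\ W (psi t) <= W x.
  apply: (closed_invariant (S := [set y | B y /\ W y <= W x])).
  - apply: closed_sublevel => // y [Ky _].
    exact: differentiable_continuous (Wd Ky).
  - exact: cont.
  - by rewrite /= psi0; split=> //; split=> //; exact: ltW.
  move=> t t0 [[Kt tr] Wt].
  have {}tr : `|psi t| < r.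
    rewrite lt_neqAle tr andbT; apply/eqP => tr'.
    by have := mW _ (conj Kt tr'); lra.
  have rs : \forall s \near t^'+, `|psi s| < r.
    have ct : `|psi s| @[s --> t] --> `|psi t|.
      by apply: cvg_comp (cont _ t0) _; exact: norm_continuous.
    by apply: cvg_within; exact: (cvgr_lt _ ct _ tr).
  have Ws : \forall s \near t^'+, W (psi s) < W x.
    (* At the origin no strict decrease of W is available, but there W = 0 < W x. *)
    have [t00|t00] := eqVneq (psi t) 0.
      have ct : W (psi s) @[s --> t] --> W 0.
        by apply: cvg_comp (cont _ t0) _; rewrite t00.
      apply: cvg_within; apply: (cvgr_lt _ ct).
      by rewrite W00; exact: Wpos.
    have : \forall s \near t^'+, W (psi s) < W (psi t).
      apply: (@is_derive_lt0_right R (W \o psi)).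
        by apply: is_derive_along (cpsi _ t0); exact: Wd.
      by apply: le_lt_trans (WG Kt) _; rewrite oppr_lt0; exact: Qpos.
    by apply: filterS => s /lt_le_trans; exact.
  apply: filterS2 rs Ws => s rs Ws; split; last exact: ltW.
  by split; [apply: rK; exact: ltW|exact: ltW].
rewrite -psi0.
apply: (lyapunov_comparison Kc K0 Qc Qpos Wd Vd WG WVG W_ge0 _ cpsi).
  by rewrite V00 W00.
by move=> t /BW[[]].
Unshelve. all: by end_near. Qed.

(* If [W < V] somewhere, take [z] minimizing [V] over the closure of that set:
   below level [V z] the two functions agree, so [V] strictly decreases along
   [G] near [z], and a [G]-curve from a nearby bad point quickly reaches a point
   of agreement, while [V - W] does not decrease along it. *)
Lemma comparison_eq x : K x -> V x = W x.
Proof.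
move=> Kx; apply/eqP; rewrite eq_le comparison_le// andbT leNgt.
apply/negP => WVx.
pose B := [set y | K y /\ W y < V y].
have BK y : closure B y -> K y.
  by move=> By; apply: Kcl; apply: closureS By => ? [].
have Bc : compact (closure B).
  by apply: subclosed_compact Kc _ => //; exact: closed_closure.
have [||z] := compact_EVT_min (f := V) _ Bc.
- by exists x; apply: subset_closure.
- apply: continuous_in_subspaceT => y; rewrite inE => By.
  by apply: differentiable_continuous; apply: Vd; exact: BK.
rewrite inE => Bz Vmin.
have Kz := BK _ Bz.
have agree y : K y -> V y < V z -> V y = W y.
  move=> Ky Vyz; apply/eqP; rewrite eq_le comparison_le// andbT leNgt.
  apply/negP => WVy; have : V z <= V y.
    by apply: Vmin; rewrite inE; apply: subset_closure.
  by rewrite leNgt Vyz.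
(* Near the origin V <= W, so no points of B accumulate there. *)
have z0 : z != 0.
  apply/eqP => z0; rewrite z0 in Bz.
  have [y [[_ WVy]]] := Bz _ comparison_ge_near0.
  by rewrite /= leNgt WVy.
have q0 : 0 < Q z by exact: Qpos.
have [_ gVW] : V z = W z /\ grad V z = grad W z.
  apply: (@eq_grad_of_eq_sublevel _ _ _ _ _ (F z)) => //.
  - exact: Vd.
  - exact: Wd.
  - by apply: le_lt_trans (VF Kz) _; rewrite oppr_lt0.
  - by apply: filterS (Vabs Kz) => y Vy Vyz; apply: agree => //; exact: Vy.
pose dV y := dot (grad V y) (G y).
have Gz : G y @[y --> within K (nbhs z)] --> G z.
  have /subspace_continuousP := continuous_subspaceW KD Gc; exact.
have dVz : dV y @[y --> within K (nbhs z)] --> dV z.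
  apply: cvg_dot => //.
  by have /subspace_continuousP := gVc; exact.
(* At z the rate [dV z] is that of W, hence at most -Q z; taking half of Q z leaves room for a
   strict bound near z. M bounds the speed of G near z. *)
pose eta := Q z / 2; pose M := `|G z| + 1.
have eta0 : 0 < eta by exact: divr_gt0.
have M0 : 0 < M by rewrite ltr_wpDl.
have [r r0 zr] : exists2 r : R, 0 < r &
    forall y, K y -> `|z - y| <= r -> dV y < - eta /\ `|G y| <= M.
  have dVe : \forall y \near within K (nbhs z), dV y < - eta.
    apply: (cvgr_lt _ dVz); rewrite /dV gVW; apply: le_lt_trans (WG Kz) _.
    by rewrite /eta; lra.
  have GM : \forall y \near within K (nbhs z), `|G y| < M.
    have cn : `|G y| @[y --> within K (nbhs z)] --> `|G z| by exact: cvg_norm.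
    by apply: (cvgr_lt _ cn); rewrite /M ltrDl.
  have : nbhs z (fun y => K y -> dV y < - eta /\ `|G y| < M).
    have : \forall y \near within K (nbhs z), dV y < - eta /\ `|G y| < M.
      exact: filterI.
    by rewrite near_withinE.
  move=> /nbhs_normP[r /= r0 zr]; exists (r / 2); first exact: divr_gt0.
  move=> y Ky yr; have : `|z - y| < r by lra.
  by move=> /zr/(_ Ky)[dVy /ltW].
(* In time tau a curve of speed at most M moves by at most r/4, so it stays within r of z if it
   starts within r/2. Meanwhile V drops by at least eta tau, more than its initial excess over V
   z. *)
pose tau := r / (4 * M).
have tau0 : 0 < tau by rewrite divr_gt0// mulr_gt0.
have Vz : V y @[y --> z] --> V z by exact: differentiable_continuous (Vd Kz).
have near_z : \forall y \near z, `|z - y| < r / 2.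
  by apply/nbhs_normP; exists (r / 2) => //=; exact: divr_gt0.
have near_Vz : \forall y \near z, V y < V z + eta * tau.
  by apply: (cvgr_lt _ Vz); rewrite ltrDl mulr_gt0.
have [y [[Ky WVy] [yz Vyz]]] := Bz _ (filterI near_z near_Vz).
have [psi [psi0 cpsi _]] := Gcurves Ky.
have cont (t : R) : 0 <= t -> psi s @[s --> t] --> psi t.
  by move=> t0; apply: is_derive_continuous; exact: cpsi.
pose S := K `&` [set w | `|z - w| <= r].
have Scl : closed S.
  apply: closedI => //.
  apply: (@closed_comp _ _ (fun w : X => `|z - w|) [set s | s <= r]) => [w _|].
    exact: dist_continuous.
  exact: closed_le.
have S0 : S (psi 0) by rewrite psi0; split=> //=; lra.
have dpsi t : 0 <= t -> K (psi t) ->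
    is_derive t 1 (V \o psi) (dV (psi t)).
  by move=> t0 Kt; apply: is_derive_along (cpsi _ t0); exact: Vd.
(* The two conditions in S support each other: within S the value V decreases, which keeps the curve
   in K, and the speed bound keeps it near z. *)
have Spsi t : 0 <= t <= tau -> S (psi t).
  apply: (@real_induction R (S \o psi) 0 tau) => //= {}t; last first.
    move=> /andP[t0 _]; apply: closed_left_limit => //.
    by apply: cont; exact: ltW.
  move=> /andP[t0 ttau] St.
  have [Kt _] : S (psi t) by apply: St; rewrite t0 lexx.
  have ptr : `|psi t - psi 0| <= M * t.
    have := @mean_value_norm_le _ _ _ psi (G \o psi) 0 t M t0.
    rewrite subr0; apply.
    - apply: derivable_within_continuous => s; rewrite in_itv/= => /andP[s0 _].
      by have [] := cpsi s s0.
    - by move=> s /andP[/ltW s0 _]; exact: cpsi.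
    - move=> s /andP[/ltW s0 /ltW st].
      have [Ks sr] : S (psi s) by apply: St; rewrite s0.
      by have [] := zr _ Ks sr.
  have tr : `|z - psi t| < r.
    have Mt : M * t < r / 4.
      have -> : r / 4 = M * tau by rewrite /tau; field; rewrite gt_eqF.
      by rewrite ltr_pM2l.
    have := ler_normD (z - psi 0) (psi 0 - psi t).
    by rewrite addrA subrK distrC in ptr *; rewrite psi0 in ptr *; lra.
  have sr : \forall s \near t^'+, `|z - psi s| < r.
    have ct : `|z - psi s| @[s --> t] --> `|z - psi t|.
      have := cvg_comp psi (fun w : X => `|z - w|) (cont t t0).
      by apply; exact: dist_continuous.
    by apply: cvg_within; exact: (cvgr_lt _ ct _ tr).
  have Vlt : \forall s \near t^'+, V (psi s) < V (psi t).
    apply: (is_derive_lt0_right (dpsi _ t0 Kt)).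
    by have [] := zr _ Kt (ltW tr); lra.
  have Ks : \forall s \near t^'+, V (psi s) < V (psi t) -> K (psi s).
    by apply: cvg_within; exact: (cont _ t0 _ (Vabs Kt)).
  apply: filterS3 sr Vlt Ks => s sr Vs Ks.
  by split; [exact: Ks|exact: ltW].
have [Ktau _] : S (psi tau) by apply: Spsi; rewrite ltW//= lexx.
have Vtau : V (psi tau) - V (psi 0) <= - eta * (tau - 0).
  apply: (@mean_value_le R (V \o psi) (dV \o psi)) => [|t /andP[t0 tt]|t tt].
  - exact: ltW.
  - by apply: dpsi => //; have [] := Spsi t; rewrite ?t0.
  - by have [Kt tr] := Spsi _ tt; have [/ltW] := zr _ Kt tr.
have VWtau : V (psi tau) = W (psi tau).
  by apply: agree => //; rewrite psi0 subr0 in Vtau; lra.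
(* W - V does not increase along the curve and is 0 at time tau, so W y >= V y, against the choice
   of y. *)
have := @mean_value_le R ((W \o psi) - (V \o psi))
  (fun t => dot (grad W (psi t)) (G (psi t)) - dV (psi t)) 0 tau 0 (ltW tau0).
rewrite -[(_ - _) tau]/(W (psi tau) - V (psi tau)).
rewrite -[(_ - _) 0]/(W (psi 0) - V (psi 0)) mul0r VWtau psi0 => Hmv.
suff : W (psi tau) - W (psi tau) - (W y - V y) <= 0 by lra.
apply: Hmv => t tt; have [Kt _] := Spsi _ tt; last first.
  by rewrite subr_le0; exact: WVG.
have /andP[t0 _] := tt.
apply: is_deriveB (dpsi _ t0 Kt).
by apply: is_derive_along (cpsi _ t0); exact: Wd.
Qed.

End TwoLyapunovFunctions.

End Comparison.

(** * The control system: completing the square, trajectories and values *)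

Section Control.
Context {R : realType} {n m : nat} (P : problem R n m).
Local Notation X := 'cV[R]_n.
Local Notation U := 'cV[R]_m.
Local Notation D := (dom P).
Local Notation f := (drift P).
Local Notation g := (input P).
Local Notation Q := (state_cost P).
Local Notation Ru := (input_cost P).
Implicit Types (mu : X -> U) (x : X) (u : U) (V W : X -> R) (K : set X).
Hypothesis wp : well_posed P.

(** The right-hand side of the HJB equation; keeping it as a term lets the next identity hold for
    every V. *)
Definition hjb_residual V x : R :=
  Q x + dot (grad V x) (f x)
    - 4^-1 * dot (grad V x) (g x *m invmx Ru *m (g x)^T *m grad V x).

(** Completing the square in u. With b = g^T grad V and s = R^-1 b one has R s = b, the improved
    policy is -s/2, and symmetry of R turns s^T R u into b^T u. *)
Lemma hamiltonian_square V x u :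
  dot (grad V x) (f x + g x *m u) = - running_cost P x u + hjb_residual V x
    + dot (u - improved P V x) (Ru *m (u - improved P V x)).
Proof.
have Rpd := wp_input_cost wp; have [Rsym _] := Rpd.
have Runit := posdef_unitmx Rpd.
rewrite /hjb_residual /running_cost /improved.
set G := grad V x; set b := (g x)^T *m G.
have -> : g x *m invmx Ru *m (g x)^T *m G = g x *m (invmx Ru *m b).
  by rewrite /b !mulmxA.
have -> : invmx Ru *m (g x)^T *m G = invmx Ru *m b by rewrite /b mulmxA.
set s := invmx Ru *m b.
have Rs : Ru *m s = b by rewrite /s mulmxA mulmxV// mul1mx.
have gb w : dot G (g x *m w) = dot b w by exact: dot_mulmx.
rewrite dotD !gb.
rewrite !mulmxDr !scaleNr !opprK -!scalemxAr Rs.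
rewrite !(dotDl, dotD, dotZl, dotZr).
have -> : dot s (Ru *m u) = dot b u by rewrite dot_mulmx Rsym Rs.
rewrite (dotC u b) (dotC s b).
lra.
Qed.

Lemma running_cost_ge x u : Q x <= running_cost P x u.
Proof. by rewrite lerDl posdef_ge0//; exact: wp_input_cost wp. Qed.

Lemma state_cost_gt0 x : D x -> x != 0 -> 0 < Q x.
Proof. by have [_ _] := wp_state_cost wp; exact. Qed.

Lemma state_cost_ge0 x : D x -> 0 <= Q x.
Proof.
move=> Dx; have [_ Q0 Qpos] := wp_state_cost wp.
by have [->|x0] := eqVneq x 0; [rewrite Q0|exact/ltW/Qpos].
Qed.

Lemma flowP mu x : has_flow P mu x -> trajectory P mu x (flow P mu x).
Proof.
move=> [phi phiP]; apply: (@xgetPex _ _ [set p | trajectory P mu x p]).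
by exists phi.
Qed.

Lemma value_ge0 mu x : value_exists P mu x -> 0 <= value P mu x.
Proof.
move=> [/flowP[_ _ flowD _] _]; apply: Rintegral_ge0 => t /=.
rewrite in_itv/= andbT => t0; apply: le_trans (running_cost_ge _ _).
by apply: state_cost_ge0; exact: flowD.
Qed.

(** Continuity of the closed loop makes the derivative converge as t tends to 0 from the right,
    which is what [extend_curve] asks for. *)
Lemma trajectory_curve mu x phi :
  {within D, continuous (closed_loop P mu)} -> trajectory P mu x phi ->
  exists psi, [/\ psi 0 = x, integral_curve (closed_loop P mu) psi &
    forall t, 0 <= t -> psi t = phi t].
Proof.
move=> Fc [phi0 phic phiD dphi].
have Fphic : {within `[0, +oo[, continuous (closed_loop P mu \o phi)}.
  apply: within_continuous_image_comp phic Fc => t /=.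
  by rewrite in_itv/= andbT; exact: phiD.
have /continuous_within_itvcyP[_ Fphi0] := Fphic.
have [psi [psiE dpsi]] := extend_curve phic Fphi0 dphi.
exists psi; split=> // [|t t0]; first by rewrite psiE.
by rewrite psiE//; exact: dpsi.
Qed.

Lemma has_curves_closed_loop mu K :
  {within D, continuous (closed_loop P mu)} ->
  (forall x, K x -> has_flow P mu x) -> has_curves D K (closed_loop P mu).
Proof.
move=> Fc flowK x /flowK[phi phiP].
have [psi [psi0 cpsi psiE]] := trajectory_curve Fc phiP.
exists psi; split=> // t t0; rewrite psiE//.
by have [_ _ phiD _] := phiP; exact: phiD.
Qed.

Lemma lyapunov_le mu K x : lyapunov P mu K -> K x ->
  dot (grad (value P mu) x) (closed_loop P mu x) <= - Q x.
Proof. by move=> lyap Kx; rewrite lyap// lerN2 running_cost_ge. Qed.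

(* The fundamental theorem of calculus gives
   [V x - lim V (psi t) = int_0^oo cost = V x]. *)
Lemma value_cvg0 mu K x psi : K `<=` D ->
  {within D, continuous (closed_loop P mu)} ->
  (forall y, K y -> value_exists P mu y) -> C1_on K (value P mu) ->
  lyapunov P mu K ->
  psi 0 = x -> integral_curve (closed_loop P mu) psi ->
  (forall t, 0 <= t -> psi t = flow P mu x t) ->
  (forall t : R, 0 <= t -> K (psi t)) ->
  value P mu (psi t) @[t --> +oo] --> (0 : R).
Proof.
move=> KD Fc Kval [Vd gVc] lyap psi0 cpsi psiE Kpsi.
set V := value P mu; set F := closed_loop P mu.
have dV (t : R) : 0 <= t ->
    is_derive t 1 (V \o psi) (dot (grad V (psi t)) (F (psi t))).
  by move=> t0; apply: is_derive_along (cpsi _ t0); apply: Vd; exact: Kpsi.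
have Vnincr (s t : R) : 0 <= s -> s <= t -> V (psi t) <= V (psi s).
  move=> s0 st; rewrite -subr_le0 -(mul0r (t - s)).
  apply: (@mean_value_le R (V \o psi)
    (fun t => dot (grad V (psi t)) (F (psi t)))) => // r /andP[sr _].
    by apply: dV; exact: (le_trans s0 sr).
  have Kr := Kpsi _ (le_trans s0 sr).
  apply: le_trans (lyapunov_le lyap Kr) _.
  by rewrite oppr_le0 state_cost_ge0//; exact: KD.
have V_ge0 (t : R) : 0 <= t -> 0 <= V (psi t).
  by move=> t0; apply: value_ge0; apply: Kval; exact: Kpsi.
(* V does not increase along the curve and is bounded below, so it converges to its infimum l; it
   remains to show l = 0. *)
pose S := [set V (psi t) | t in `[0, +oo[ : set R].
have Sinf : has_inf S.
  split; first by exists (V (psi 0)), 0 => //=; rewrite in_itv/= lexx.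
  by exists 0 => _ [t /= + <-]; rewrite in_itv/= andbT; exact: V_ge0.
pose l := inf S.
have Vl : V (psi t) @[t --> +oo] --> l.
  apply/cvgrPdist_lt => e e0.
  have [_ [T /= T0 <-] VT] := inf_adherent e0 Sinf.
  rewrite in_itv/= andbT in T0.
  near=> t.
  have Tt : T <= t by near: t; exact: nbhs_pinfty_ge (num_real T).
  have lV : l <= V (psi t).
    apply: ge_inf; first by case: Sinf.
    by exists t => //=; rewrite in_itv/= andbT; exact: le_trans Tt.
  have := Vnincr _ _ T0 Tt; rewrite -/l in VT.
  by rewrite distrC ger0_norm ?subr_ge0//; lra.
suff -> : 0 = l by exact: Vl.
have costE (t : R) : 0 <= t ->
    cost_along P mu x t = - dot (grad V (psi t)) (F (psi t)).
  by move=> t0; rewrite /cost_along -psiE// lyap ?opprK//; exact: Kpsi.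
(* The Lyapunov equation expresses the cost through grad V and the closed loop, both continuous on
   K. *)
have costc : {within `[0, +oo[, continuous (cost_along P mu x)}.
  have cpc : {within `[0, +oo[, continuous psi}.
    apply: derivable_within_continuous => t; rewrite in_itv/= andbT => t0.
    by have [] := cpsi t t0.
  have dVc : {within K, continuous (fun y => dot (grad V y) (F y))}.
    apply/subspace_continuousP => y Ky; apply: cvg_dot.
      by have /subspace_continuousP := gVc; exact.
    by have /subspace_continuousP := continuous_subspaceW KD Fc; exact.
  have dVpc : {within `[0, +oo[,
      continuous ((fun y => dot (grad V y) (F y)) \o psi)}.
    apply: within_continuous_image_comp cpc dVc => t /=.
    by rewrite in_itv/= andbT; exact: Kpsi.
  apply: (@subspace_eq_continuous _ _ _
    (fun t => - dot (grad V (psi t)) (F (psi t)))).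
    move=> t; rewrite inE/= in_itv/= andbT => t0.
    by rewrite /from_subspace costE.
  apply/subspace_continuousP => t tI; apply: cvgN.
  by have /subspace_continuousP := dVpc; apply.
have dNV (t : R) : 0 <= t -> is_derive t 1 (- (V \o psi)) (cost_along P mu x t).
  by move=> t0; rewrite costE//; apply: is_deriveN; exact: dV.
(* -V is an antiderivative of the cost along the curve, with limit -l. The integral V x thus equals
   V x - l, whence l = 0. *)
have intE := @ge0_continuous_FTC2y R (cost_along P mu x) (- (V \o psi)) 0 (- l)
  _ costc (cvgN Vl).
have : value P mu x = - l + V (psi 0).
  rewrite /value /Rintegral intE -?[(- (V \o psi)) 0]/(- V (psi 0)) /=
    ?opprK//.
  - move=> t t0; rewrite costE// oppr_ge0.
    apply: le_trans (lyapunov_le lyap (Kpsi _ t0)) _.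
    by rewrite oppr_le0 state_cost_ge0//; apply: KD; exact: Kpsi.
  - by move=> t /ltW/dNV[].
  - by apply: cvg_at_right_filter; exact: is_derive_continuous (dNV _ (lexx 0)).
  - move=> t; rewrite in_itv/= andbT => /ltW/dNV[_ <-].
    by rewrite derive1E.
by rewrite psi0 -/V; lra.
Unshelve. all: by end_near. Qed.

(** The curve from 0 comes near 0 at arbitrarily late times. If V 0 > 0, then V exceeds V 0 / 2 near
    0, although V tends to 0 along the curve. *)
Lemma value_origin mu K : compact K -> nbhs (0 : X) K -> K `<=` D ->
  {within D, continuous (closed_loop P mu)} ->
  (forall y, K y -> value_exists P mu y) -> C1_on K (value P mu) ->
  lyapunov P mu K -> absorbs_sublevels K (value P mu) -> value P mu 0 = 0.
Proof.
move=> Kc K0 KD Fc Kval VC1 lyap Vabs; have [Vd gVc] := VC1.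
have K00 := nbhs_singleton K0.
have Kcl : closed K by apply: compact_closed Kc; exact: norm_hausdorff.
have [psi [psi0 cpsi psiE]] := trajectory_curve Fc (flowP (Kval _ K00).1).
have Qpos y : K y -> y != 0 -> 0 < Q y by move=> /KD; exact: state_cost_gt0.
have Kpsi : forall t : R, 0 <= t -> K (psi t).
  apply: (absorbing_invariant Kcl K0 Vabs Vd _ cpsi); last by rewrite psi0.
  move=> y Ky y0; apply: le_lt_trans (lyapunov_le lyap Ky) _.
  by rewrite oppr_lt0; exact: Qpos.
have Vpsi := value_cvg0 KD Fc Kval VC1 lyap psi0 cpsi psiE Kpsi.
have Qc : {within K, continuous Q}.
  by apply: continuous_subspaceW KD _; have [] := wp_state_cost wp.
have V_ge0 y : K y -> 0 <= value P mu y by move=> /Kval; exact: value_ge0.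
apply/eqP; rewrite eq_le V_ge0// andbT leNgt; apply/negP => V0.
have V2 : 0 < value P mu 0 / 2 by exact: divr_gt0.
have [T [_ TV]] := cvgr_lt _ Vpsi _ V2.
have Vc : value P mu y @[y --> (0 : X)] --> value P mu 0.
  exact: differentiable_continuous (Vd _ K00).
have near0 : \forall y \near (0 : X), value P mu 0 / 2 < value P mu y.
  by apply: (cvgr_gt _ Vc); lra.
have [|t] := curve_meets_nbhs0 (T := Num.max 0 (T + 1)) Kc Qc Qpos Vd
  (fun y => lyapunov_le lyap) V_ge0 cpsi Kpsi near0.
  by rewrite le_max lexx.
rewrite ge_max => /andP[t0 Tt] /=.
have : value P mu (psi t) < value P mu 0 / 2 by apply: TV; lra.
by move=> /lt_trans /[apply]; rewrite ltxx.
Qed.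

End Control.

(** Away from 0 the vector F x is a direction of descent, so [eq_grad_of_eq_sublevel] applies. At 0
    the functions agree on a full neighbourhood. *)
Lemma eq_grad_on (R : realType) (n : nat) (K : set 'cV[R]_n)
    (V W : 'cV[R]_n -> R) (F : 'cV[R]_n -> 'cV[R]_n) :
  nbhs (0 : 'cV[R]_n) K -> absorbs_sublevels K V ->
  (forall x, K x -> differentiable V x) ->
  (forall x, K x -> differentiable W x) ->
  (forall x, K x -> x != 0 -> dot (grad V x) (F x) < 0) ->
  (forall x, K x -> V x = W x) ->
  forall x, K x -> grad V x = grad W x.
Proof.
move=> K0 Vabs Vd Wd VF VW x Kx; have [->|x0] := eqVneq x 0.
  apply/colP => i; rewrite !mxE; apply: near_eq_derive.
  by apply: filterS K0 => y; exact: VW.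
apply: (eq_grad_of_eq_sublevel (Vd _ Kx) (Wd _ Kx) (VF _ Kx x0) _).2.
by apply: filterS (Vabs _ Kx) => y Ky Vyx; apply: VW; exact: Ky.
Qed.

(** * Dissipation along closed loops for solutions of the HJB equation *)

Section HJB.
Context {R : realType} {n m : nat} (P : problem R n m).
Hypothesis wp : well_posed P.
Implicit Types (x : 'cV[R]_n) (V : 'cV[R]_n -> R) (mu : 'cV[R]_n -> 'cV[R]_m).

Lemma hjb_dissipation_ge V mu x : hjb_residual P V x = 0 ->
  - running_cost P x (mu x) <= dot (grad V x) (closed_loop P mu x).
Proof.
move=> hjb; rewrite hamiltonian_square// hjb addr0 lerDl posdef_ge0//.
exact: wp_input_cost wp.
Qed.

Lemma hjb_dissipation_improved V mu x : mu x = improved P V x ->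
  dot (grad V x) (closed_loop P mu x) =
    - running_cost P x (mu x) + hjb_residual P V x.
Proof.
move=> muE; rewrite hamiltonian_square// -muE subrr.
by rewrite mulmx0 /dot mulmx0 mxE addr0.
Qed.

(** Equality leaves no room for the square, so definiteness of R makes the deviation from the
    improved policy vanish. *)
Lemma hjb_dissipation_eq V mu x : hjb_residual P V x = 0 ->
  dot (grad V x) (closed_loop P mu x) = - running_cost P x (mu x) ->
  mu x = improved P V x.
Proof.
move=> hjb; rewrite hamiltonian_square// hjb addr0 -[X in _ = X -> _]addr0.
by move=> /addrI /(posdef_eq0 (wp_input_cost wp)) /subr0_eq.
Qed.

End HJB.

(** * Regions of the iteration: compactness and absorption *)

Section PolicyIteration.
Context {R : realType} {n m : nat} (P : problem R n m).
Context (Omstar : set 'cV[R]_n) (mu : nat -> 'cV[R]_n -> 'cV[R]_m)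
  (Om : nat -> set 'cV[R]_n) (c : nat -> R).
Hypothesis pi : policy_iteration P Omstar mu Om c.
Implicit Types (i : nat) (x : 'cV[R]_n).

Lemma iteration_value_exists i x : Om i x -> value_exists P (mu i) x.
Proof. by move=> Omx; exact: nbhs_singleton ((pi_C1 pi i).1 _ Omx). Qed.

Lemma iteration_region_sub i : Om i `<=` Omstar.
Proof.
elim: i => [|i IH]; first exact: pi_Omstar pi.
by move=> x /(pi_nested pi)/IH.
Qed.

(** Nestedness confines the sublevel set to the compact [Om i], on which the value is continuous, so
    it is closed there. *)
Lemma iteration_region_compact i : compact (Om i).
Proof.
elim: i => [|i IH]; first exact: pi_compact pi.
have OmE : Om i.+1 = [set x | Om i x /\ value P (mu i) x <= c i].
  apply/seteqP; split=> [x Omx|x [Omx Vx]].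
    split; first exact: (pi_nested pi).
    by move: Omx; rewrite (pi_update pi) => -[].
  by rewrite (pi_update pi); split=> //; exact: iteration_value_exists.
have sub : Om i.+1 `<=` Om i by exact: (pi_nested pi).
have cl : closed (Om i) by apply: compact_closed IH; exact: norm_hausdorff.
apply: subclosed_compact IH sub; rewrite OmE.
apply: closed_sublevel => // x Omx.
exact: differentiable_continuous ((pi_C1 pi i).2.1 _ Omx).
Qed.

(** A point of [Om i.+1] lies in [Om i], so the value exists on a whole neighbourhood of it; nearby
    points of smaller value are then in the sublevel set. *)
Lemma iteration_absorbs i : absorbs_sublevels (Om i.+1) (value P (mu i)).
Proof.
move=> x Omx; have := (pi_C1 pi i).1 _ (pi_nested pi Omx).
apply: filterS => y Vy Vyx; move: Omx; rewrite (pi_update pi) => -[_ Vx].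
by split=> //; exact: le_trans (ltW Vyx) Vx.
Qed.

End PolicyIteration.

Theorem theorem4 (R : realType) (n m : nat) (P : problem R n m)
    (mustar : 'cV[R]_n -> 'cV[R]_m) (Omstar : set 'cV[R]_n)
    (mu : nat -> 'cV[R]_n -> 'cV[R]_m) (Om : nat -> set 'cV[R]_n)
    (c : nat -> R) (k : nat) :
  well_posed P ->
  optimal_solution P mustar Omstar ->
  policy_iteration P Omstar mu Om c ->
  (forall x, Om k.+1 x -> value P (mu k) x = value P (mu k.+1) x) ->
  forall x, Om k.+1 x ->
    (mu k x = mu k.+1 x /\ mu k.+1 x = mustar x) /\
    (value P (mu k) x = value P (mu k.+1) x /\
     value P (mu k.+1) x = value P mustar x).
Proof.
move=> wp opt pi eqV x Kx.
set K := Om k.+1 in eqV Kx; set V := value P (mu k) in eqV *.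
set W := value P mustar.
have KOm : K `<=` Om k by exact: (pi_nested pi).
have KOmstar : K `<=` Omstar by exact: (iteration_region_sub pi).
have KD : K `<=` dom P  by move=> y /KOmstar; exact: (opt_dom opt).
have Kc : compact K by exact: (iteration_region_compact pi).
have K0 : nbhs (0 : 'cV[R]_n) K := (pi_region pi k.+1).1.
have Vabs : absorbs_sublevels K V by exact: (iteration_absorbs pi).
have VC1 : C1_on K V.
  have [_ [Vd gVc]] := pi_C1 pi k.
  by split; [move=> y /KOm; exact: Vd|exact: continuous_subspaceW gVc].
have [Vd gVc] := VC1.
have V'd y : K y -> differentiable (value P (mu k.+1)) y.
  by have [_ [V'd _]] := pi_C1 pi k.+1; exact: V'd.
have Wd y : K y -> differentiable W y.
  by move=> /KOmstar; have [_ [Wd _]] := opt_C1 opt; exact: Wd.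
have Vex y : K y -> value_exists P (mu k) y.
  by move=> /KOm; exact: (iteration_value_exists pi).
have lyap : lyapunov P (mu k) K by move=> y /KOm; exact: (pi_evaluation pi).
have Fc := locally_lipschitz_continuous (pi_lipschitz pi k).
have Gc := locally_lipschitz_continuous (opt_lipschitz opt).
have Qpos y : K y -> y != 0 -> 0 < state_cost P y.
  by move=> /KD; exact: state_cost_gt0 wp y.
have VF y (Ky : K y) := lyapunov_le wp lyap Ky.
have VFlt y : K y -> y != 0 -> dot (grad V y) (closed_loop P (mu k) y) < 0.
  move=> Ky y0; apply: le_lt_trans (VF y Ky) _.
  by rewrite oppr_lt0; exact: Qpos.
have gradV' := eq_grad_on K0 Vabs Vd V'd VFlt eqV.
have mu'E y : K y -> mu k.+1 y = improved P V y.
  by move=> /KOm; exact: (pi_improvement pi).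
(* As mu_{k+1} improves V, the derivative of V along it differs from minus the cost by exactly the
   residual; the Lyapunov equation of mu_{k+1} makes this 0. *)
have hjbV y : K y -> hjb_residual P V y = 0.
  move=> Ky; have := hjb_dissipation_improved wp (mu'E y Ky).
  rewrite gradV'// (pi_evaluation pi Ky) -[X in X = _ -> _]addr0.
  by move=> /addrI <-.
have hjbW y : K y -> hjb_residual P W y = 0.
  by move=> /KOmstar Ky; apply/esym; exact: (opt_HJB opt).
(* V satisfies HJB and the Lyapunov equation of mu_k at once, so mu_k is already the improved
   policy, that is mu_{k+1}. *)
have muE y : K y -> mu k y = improved P V y.
  by move=> Ky; exact: (hjb_dissipation_eq wp (hjbV y Ky) (lyap y Ky)).
have mustarE y : K y -> mustar y = improved P W y.
  by move=> /KOmstar; exact: (opt_policy opt).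
have WG_E y : K y -> dot (grad W y) (closed_loop P mustar y) =
    - running_cost P y (mustar y).
  move=> Ky; rewrite (hjb_dissipation_improved wp (mustarE y Ky)).
  by rewrite hjbW// addr0.
have [_ W00 Wpos] := opt_posdef opt.
have Qc : {within K, continuous (state_cost P)}.
  by apply: continuous_subspaceW KD _; have [] := wp_state_cost wp.
have V_ge0 y : K y -> 0 <= V y by move=> /Vex; exact: value_ge0.
have V00 : V 0 = 0 by exact: (value_origin wp Kc K0 KD Fc Vex VC1 lyap Vabs).
have WposK y : K y -> y != 0 -> 0 < W y by move=> /KOmstar; exact: Wpos.
have Fcurves : has_curves (dom P) K (closed_loop P (mu k)).
  by apply: has_curves_closed_loop Fc _ => y /Vex[].
have Gcurves : has_curves (dom P) K (closed_loop P mustar).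
  apply: has_curves_closed_loop Gc _ => y /KOmstar Ky.
  by have [] := nbhs_singleton ((opt_C1 opt).1 _ Ky).
(* Being an HJB solution, W falls no faster than the cost accrues under any policy, while V falls
   exactly at the cost along mu_k. Along mu^* the roles are exchanged. *)
have VWF y : K y -> dot (grad V y) (closed_loop P (mu k) y) <=
    dot (grad W y) (closed_loop P (mu k) y).
  move=> Ky; rewrite (lyap y Ky).
  exact: (hjb_dissipation_ge wp (mu k) (hjbW y Ky)).
have WG y : K y -> dot (grad W y) (closed_loop P mustar y) <= - state_cost P y.
  by move=> Ky; rewrite WG_E// lerN2 running_cost_ge.
have WVG y : K y -> dot (grad W y) (closed_loop P mustar y) <=
    dot (grad V y) (closed_loop P mustar y).
  move=> Ky; rewrite WG_E//.
  exact: (hjb_dissipation_ge wp mustar (hjbV y Ky)).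
have VW := comparison_eq Kc K0 KD Qc Qpos Vd gVc Vabs V_ge0 V00 Wd W00 WposK
  Fcurves Gcurves Gc VF VWF WG WVG.
(* Equal values give equal gradients once more, hence equal improved policies. *)
have gradW := eq_grad_on K0 Vabs Vd Wd VFlt VW.
split; last by rewrite -(eqV x Kx); split=> //; exact: VW.
have mu_eq : mu k.+1 x = mustar x.
  by rewrite (mu'E x Kx) (mustarE x Kx) /improved (gradW x Kx).
by split=> //; rewrite (muE x Kx) (mu'E x Kx).
Qed.
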